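(* Let $(G_i, \Omega_i)$ be a sequence of finite $2$-transitive permutation groups of degrees $n_i = |\Omega_i| \to \infty$ with $\ln |G_i| = n_i^{o(1)}$, and let $V_i$ be the deleted permutation modules. Then $$\mathsf{C}(V_i) = (1 + o(1)) \ln \dim V_i \qquad \text{as } i \to \infty.$$
   Context: For a group $G$ acting $2$-transitively on a finite set $\Omega$ with $|\Omega| = n$, the deleted permutation module is the subspace $V \leq \mathbf{C}[\Omega]$ of functions on $\Omega$ summing to zero; it has dimension $n-1$ and is an irreducible representation of $G$. For a group $H$ acting linearly on a finite-dimensional complex vector space $V$ and a nonzero subspace $U \leq V$, the group-additive diameter is $$\mathrm{diam}_+^{H}(V,U) = \min\{ m \mid g_1\cdot U + \dots + g_m\cdot U = V \text{ for some } g_1,\dots,g_m \in H\}.$$ If $H$ acts irreducibly on $V$, put $\mathsf{R}(V,U) = \mathrm{diam}_+^{H}(V,U) / \lceil \dim V/\dim U\rceil$, and the covering complexity of $V$ (with respect to $H$) is $\mathsf{C}(V) = \max_{0 \neq U \leq V} \mathsf{R}(V,U)$. In the claim the group acting on $V_i$ is $G_i$. *)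

(* Defs.v *)
From HB Require Import structures.
From mathcomp Require Import all_boot all_order all_algebra all_fingroup.
From mathcomp Require Import all_solvable.
From mathcomp Require Import complex.
From mathcomp Require Import all_classical all_reals all_analysis.

Set Implicit Arguments.
Unset Strict Implicit.
Unset Printing Implicit Defensive.

Import Order.TTheory GRing.Theory Num.Theory.
Import numFieldNormedType.Exports.

Local Open Scope classical_set_scope.
Local Open Scope ring_scope.

(* The group H acts on V, a subspace of the finite-dimensional space W, through
   rho : gT -> 'End(W). *)
Definition translates_span (R : realType) (gT : finGroupType)
    (W : vectType R[i]) (rho : gT -> 'End(W)) (H : {group gT})
    (V U : {vspace W}) (m : nat) : Prop :=
  exists g : 'I_m -> gT, (forall j, g j \in H) /\
    (\sum_(j < m) (rho (g j) @: U))%VS = V.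

(* A minimum over a set of natural numbers, equal to +oo if the set is empty;
   see diam_addP. *)
Definition diam_add (R : realType) (gT : finGroupType)
    (W : vectType R[i]) (rho : gT -> 'End(W)) (H : {group gT})
    (V U : {vspace W}) : \bar R :=
  ereal_inf [set (m%:R)%:E | m in translates_span rho H V U].

Definition diam_ratio (R : realType) (gT : finGroupType)
    (W : vectType R[i]) (rho : gT -> 'End(W)) (H : {group gT})
    (V U : {vspace W}) : \bar R :=
  (diam_add rho H V U *
   ((Num.ceil ((\dim V)%:R / (\dim U)%:R : R))%:~R^-1)%:E)%E.

(* The supremum is a maximum as soon as V != 0; see covering_complexityP. *)
Definition covering_complexity (R : realType) (gT : finGroupType)
    (W : vectType R[i]) (rho : gT -> 'End(W)) (H : {group gT})
    (V : {vspace W}) : \bar R :=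
  ereal_sup [set diam_ratio rho H V U | U in
               [set U : {vspace W} | U != 0%VS /\ (U <= V)%VS]].

Definition permmod (R : realType) (Omega : finType) : vectType R[i] :=
  {ffun Omega -> R[i]^o}.

Definition permmod_translate (R : realType) (Omega : finType)
    (s : {perm Omega}) (f : permmod R Omega) : permmod R Omega :=
  [ffun w => f (s^-1%g w)].

Lemma permmod_translate_is_linear (R : realType) (Omega : finType)
    (s : {perm Omega}) : linear (@permmod_translate R Omega s).
Proof. by move=> a f g; apply/ffunP => w; rewrite !ffunE. Qed.

HB.instance Definition _ (R : realType) (Omega : finType) (s : {perm Omega}) :=
  GRing.isLinear.Build R[i] (permmod R Omega) (permmod R Omega) *:%R
    (@permmod_translate R Omega s) (@permmod_translate_is_linear R Omega s).

(* s sends the basis vector of w to the basis vector of s w. *)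
Definition permmod_action (R : realType) (Omega : finType) (s : {perm Omega}) :
  'End(permmod R Omega) := linfun (@permmod_translate R Omega s).

Definition coord_sum (R : realType) (Omega : finType)
    (f : permmod R Omega) : R[i]^o :=
  \sum_(w : Omega) f w.

Lemma coord_sum_is_linear (R : realType) (Omega : finType) :
  linear (@coord_sum R Omega).
Proof.
move=> a f g; rewrite /coord_sum scaler_sumr -big_split /=.
by apply: eq_bigr => w _; rewrite !ffunE.
Qed.

HB.instance Definition _ (R : realType) (Omega : finType) :=
  GRing.isLinear.Build R[i] (permmod R Omega) R[i]^o *:%R
    (@coord_sum R Omega) (@coord_sum_is_linear R Omega).

Definition deleted_module (R : realType) (Omega : finType) :
  {vspace permmod R Omega} := lker (linfun (@coord_sum R Omega)).

Lemma permmod_actionE (R : realType) (Omega : finType) (s : {perm Omega})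
  (f : permmod R Omega) (w : Omega) :
  permmod_action R s f w = f (s^-1%g w).
Proof. by rewrite lfunE ffunE. Qed.

Lemma permmod_action1 (R : realType) (Omega : finType) :
  permmod_action R (1%g : {perm Omega}) = \1%VF.
Proof.
by apply/lfunP => f; apply/ffunP => w; rewrite permmod_actionE id_lfunE invg1 perm1.
Qed.

(* Permutations compose from left to right: (s * t) w = t (s w). *)
Lemma permmod_actionM (R : realType) (Omega : finType) (s t : {perm Omega}) :
  permmod_action R (s * t)%g = (permmod_action R t \o permmod_action R s)%VF.
Proof.
apply/lfunP => f; apply/ffunP => w.
by rewrite comp_lfunE !permmod_actionE invMg permM.
Qed.

Lemma mem_deleted_module (R : realType) (Omega : finType)
  (f : permmod R Omega) :
  (f \in deleted_module R Omega) = (\sum_(w : Omega) f w == 0).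
Proof. by rewrite memv_ker lfunE. Qed.

Lemma permmod_action_deleted (R : realType) (Omega : finType) (s : {perm Omega}) :
  (permmod_action R s @: deleted_module R Omega)%VS = deleted_module R Omega.
Proof.
have sub t : (permmod_action R t @: deleted_module R Omega
              <= deleted_module R Omega)%VS.
  apply/subvP => _ /memv_imgP[f + ->]; rewrite !mem_deleted_module.
  move=> /eqP sf; apply/eqP; rewrite -[RHS]sf.
  rewrite [RHS](reindex_inj (@perm_inj _ t^-1%g)) /=.
  by apply: eq_bigr => w _; rewrite permmod_actionE.
apply/eqP; rewrite eqEsubv sub /=.
rewrite -[X in (X <= _)%VS]lim1g -permmod_action1 -(mulVg s) permmod_actionM limg_comp.
exact/limgS/sub.
Qed.

Lemma dim_deleted_module (R : realType) (Omega : finType) :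
  \dim (deleted_module R Omega) = #|Omega|.-1.
Proof.
have := limg_ker_dim (linfun (@coord_sum R Omega)) fullv.
rewrite capfv dimvf /dim /= muln1 -/(deleted_module R Omega).
have [w0 _ | Omega0] := pickP Omega; last first.
  move: (eq_card0 Omega0) => -> /eqP.
  by rewrite addn_eq0 => /andP[/eqP].
suff -> : limg (linfun (@coord_sum R Omega)) = fullv.
  by rewrite dimvf /dim /= => <-; rewrite addn1.
apply/eqP; rewrite eqEsubv subvf /=; apply/subvP => c _.
apply/memv_imgP; exists [ffun w => if w == w0 then c else 0]; first exact: memvf.
rewrite lfunE /= /coord_sum (bigD1 w0) //= ffunE eqxx big1 ?addr0 // => w /negPf nw.
by rewrite ffunE nw.
Qed.

Lemma diam_addP (R : realType) (gT : finGroupType) (W : vectType R[i])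
    (rho : gT -> 'End(W)) (H : {group gT}) (V U : {vspace W}) :
  ((forall m, ~ translates_span rho H V U m) /\ diam_add rho H V U = +oo%E) \/
  exists m, [/\ translates_span rho H V U m,
    (forall k, translates_span rho H V U k -> (m <= k)%N) &
    diam_add rho H V U = (m%:R)%:E].
Proof.
have [[m0 m0P]|none] := pselect (exists m, translates_span rho H V U m); last first.
  left; split=> [m mP|]; first by apply: none; exists m.
  apply/eqP; rewrite eq_le leey /=; apply: le_ereal_inf_tmp => _ [m mP <-].
  by case: none; exists m.
right; have ex : exists m, `[< translates_span rho H V U m >].
  by exists m0; apply/asboolP.
case: (ex_minnP ex) => m /asboolP mP mmin; exists m; split => //.
  by move=> k kP; apply/mmin/asboolP.
apply/eqP; rewrite eq_le; apply/andP; split.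
  by apply: ereal_inf_lbound; exists m.
apply: le_ereal_inf_tmp => _ [k kP <-]; rewrite lee_fin ler_nat.
exact/mmin/asboolP.
Qed.

Lemma translates_span_card (R : realType) (gT : finGroupType)
    (W : vectType R[i]) (rho : gT -> 'End(W)) (H : {group gT})
    (V U : {vspace W}) (m : nat) :
  translates_span rho H V U m ->
  exists2 k, (k <= #|gT|)%N & translates_span rho H V U k.
Proof.
move=> [g [gH gV]]; pose A := [set g j | j : 'I_m]%SET.
exists #|A|; first exact: max_card.
exists (fun j => enum_val j); split.
  by move=> j; have /imsetP[i _ ->] := enum_valP j.
rewrite -gV; apply/eqP; rewrite eqEsubv; apply/andP; split.
  apply/subv_sumP => x _; have /imsetP[j _ ->] := enum_valP x.
  by rewrite (bigD1 j) //= addvSl.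
apply/subv_sumP => j _; have gA : g j \in A by apply: imset_f.
by rewrite (bigD1 (enum_rank_in gA (g j))) //= enum_rankK_in // addvSl.
Qed.

Lemma covering_complexityP (R : realType) (gT : finGroupType)
    (W : vectType R[i]) (rho : gT -> 'End(W)) (H : {group gT})
    (V : {vspace W}) : V != 0%VS ->
  exists U : {vspace W}, [/\ U != 0%VS, (U <= V)%VS,
    covering_complexity rho H V = diam_ratio rho H V U &
    forall U' : {vspace W}, U' != 0%VS -> (U' <= V)%VS ->
      (diam_ratio rho H V U' <= diam_ratio rho H V U)%E].
Proof.
move=> V0.
suff [U [U0 UV Umax]] : exists U : {vspace W}, [/\ U != 0%VS, (U <= V)%VS &
    forall U' : {vspace W}, U' != 0%VS -> (U' <= V)%VS ->
      (diam_ratio rho H V U' <= diam_ratio rho H V U)%E].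
  exists U; split=> //; apply/eqP; rewrite eq_le; apply/andP; split.
    by apply: ge_ereal_sup => _ [U' [U'0 U'V] <-]; exact: Umax.
  by apply: ereal_sup_ubound; exists U.
have [[U [U0 UV Uoo]]|fin] := pselect (exists U : {vspace W},
    [/\ U != 0%VS, (U <= V)%VS & diam_add rho H V U = +oo%E]).
  exists U; split=> // U' _ _; suff -> : diam_ratio rho H V U = +oo%E by rewrite leey.
  rewrite /diam_ratio Uoo gt0_mulye // lte_fin invr_gt0 ltr0z ceil_gt0.
  by rewrite divr_gt0 // ltr0n lt0n dimv_eq0.
pose T : finType := ('I_#|gT|.+1 * 'I_(\dim V).+1)%type.
pose val (p : T) : R :=
  p.1%:R * (Num.ceil ((\dim V)%:R / (p.2 : nat)%:R : R))%:~R^-1.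
pose P (p : T) := `[< exists U : {vspace W}, [/\ U != 0%VS, (U <= V)%VS,
    diam_ratio rho H V U = (val p)%:E & \dim U = p.2] >].
have PU (U : {vspace W}) : U != 0%VS -> (U <= V)%VS ->
    exists2 p : T, P p & diam_ratio rho H V U = (val p)%:E.
  move=> U0 UV; case: (diam_addP rho H V U) => [[_ Uoo]|[m [mP mmin mE]]].
    by case: fin; exists U.
  have [k kle /mmin mk] := translates_span_card mP.
  have mlt : (m < #|gT|.+1)%N by rewrite ltnS (leq_trans mk).
  have dlt : (\dim U < (\dim V).+1)%N by rewrite ltnS dimvS.
  have E : diam_ratio rho H V U = (val (Ordinal mlt, Ordinal dlt))%:E.
    by rewrite /diam_ratio mE -EFinM.
  by exists (Ordinal mlt, Ordinal dlt) => //; apply/asboolP; exists U.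
have [p0 Pp0 _] := PU V V0 (subvv V).
case: (@Order.TotalTheory.arg_maxP _ _ _ p0 P val Pp0) => p /asboolP[U [U0 UV Ep _]] pmax.
exists U; split=> // U' U'0 U'V; have [q Pq ->] := PU U' U'0 U'V.
by rewrite Ep lee_fin; apply: pmax.
Qed.

(* Main.v *)
Require Import Defs.
From HB Require Import structures.
From mathcomp Require Import all_boot all_order all_algebra all_fingroup.
From mathcomp Require Import all_solvable.
From mathcomp Require Import complex.
From mathcomp Require Import all_classical all_reals all_analysis.
From mathcomp Require Import zify ring lra.

(** Write n for the degree of G, V for the deleted permutation module and
    N = n - 1 for its dimension. Both bounds on the covering complexity of V
    come from random choices.

    Upper bound: C(V) <= 1 + ln N. Fix subspaces U and W of V with orthonormal
    bases a_i and b_j. For a 2-transitive group, sum-zero vectors satisfy the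
    relation of Schur orthogonality, the average over s in G of
    |<s a_i, b_j>|^2 being 1/N ([sum_sq_inner_translates]), whereas
    dim (sU :&: W) is at most the sum of the |<s a_i, b_j>|^2
    ([dim_cap_le]). Hence some s in G has
    dim (sU :&: W) <= dim U dim W / N, which means that adding sU to W
    multiplies the codimension of W in V by at most 1 - dim U / N. Repeating
    this more than (N / dim U) ln N times brings the codimension below 1
    ([exists_few_translates]).

    Lower bound: take for U the sum-zero functions supported in a subset A of
    the n points. If m translates of U span V, then the corresponding m
    translates of A cover all the points. Colour the points at random with k
    colours and let A be the largest colour class, so that |A| >= n/k. For
    given s_1, ..., s_m in G and a given colour, a point x is left uncovered
    with probability at least q = (1 - 1/k)^m, and these events are independent
    for points x whose blocks {s_j^-1 x} are disjoint; a maximal family of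
    disjoint blocks has at least n/m^2 members. So the translates cover with
    probability at most (1 - q)^(n/m^2) ([card_colour_class_covers]). For
    m <= (1 - e)(k - 1) ln n this is at most exp(- n^e / m^2), small enough
    for a union bound over the k |G|^m choices of the colour and the s_j, because
    ln |G| = n^o(1) and m = O(ln n) ([union_bound_lt1]). A colouring that
    escapes all the coverings gives diam(V, U) > m with N / dim U <= k + 1, and
    so C(V) >= (1 - e) ((k - 1)/(k + 1)) ln n ([covering_complexity_ln_ge]).
    Finally k can be taken large and e small. *)

Set Implicit Arguments.
Unset Strict Implicit.
Unset Printing Implicit Defensive.

Import Order.TTheory GRing.Theory Num.Theory.
Import numFieldNormedType.Exports.

Local Open Scope ring_scope.

(** * Random colourings and coverings by translates *)

Section Colourings.
Variables (R : realFieldType) (T : finType) (k : nat).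
Implicit Types (c : {ffun T -> 'I_k}) (E : pred {ffun T -> 'I_k}).
Implicit Types (A S : {set T}) (v : 'I_k).

Definition independent_of S E :=
  forall c c', {in ~: S, c =1 c'} -> E c = E c'.

Let q : R := 1 - k%:R^-1.

(** Swapping two colours at t alone preserves E, so the k possible colours of t
    are equally frequent in E. *)
Lemma card_colour_at E t v : independent_of [set t] E ->
  (#|[set c | E c & c t == v]| * k = #|[set c | E c]|)%N.
Proof.
move=> indE.
pose recolour (w : 'I_k) c := [ffun x => if x == t then tperm v w (c x) else c x].
have recolourK w : involutive (recolour w).
  by move=> c; apply/ffunP => x; rewrite !ffunE; case: eqP => // _; rewrite tpermK.
have same w : #|[set c | E c & c t == w]| = #|[set c | E c & c t == v]|.
  rewrite -(card_imset _ (inv_inj (recolourK w))); apply: eq_card => c.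
  rewrite -[c](recolourK w) mem_imset ?inE; last exact: inv_inj (recolourK w).
  rewrite (indE (recolour w (recolour w c)) (recolour w c)); last first.
    by move=> x; rewrite !inE /= [recolour w (recolour w c) x]ffunE => /negPf ->.
  have -> : (recolour w (recolour w c) t == v) = (recolour w c t == w).
    rewrite [recolour w (recolour w c) t]ffunE eqxx -[X in _ == X](tpermL w v).
    by rewrite tpermC (inj_eq (@perm_inj _ _)).
  by [].
transitivity (\sum_(w : 'I_k) #|[set c | E c & c t == v]|)%N.
  by rewrite sum_nat_const card_ord mulnC.
rewrite -[RHS]sum1_card (partition_big (fun c => c t) xpredT) //=.
apply: eq_bigr => w _; rewrite -(same w) -sum1_card.
by apply: eq_bigl => c; rewrite !inE.
Qed.

(** The colours of the points of S are independent of E and of each other, and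
    each differs from v with probability q. *)
Lemma card_avoid E S v : (0 < k)%N -> independent_of S E ->
  #|[set c | E c & [forall u in S, c u != v]]|%:R = q ^+ #|S| * #|[set c | E c]|%:R.
Proof.
move=> k_gt0; move Hn : #|S| => n; elim: n E S Hn => [|n IH] E S cardS indE.
  rewrite expr0 mul1r; congr (_ %:R); apply: eq_card => c; rewrite !inE.
  move/eqP: cardS; rewrite cards_eq0 => /eqP ->.
  by rewrite andb_idr // => _; apply/forall_inP => t; rewrite inE.
have [t tS] : exists t, t \in S by apply/card_gt0P; rewrite cardS.
pose E' c := E c && (c t != v).
have -> : [set c | E c & [forall u in S, c u != v]] =
          [set c | E' c & [forall u in S :\ t, c u != v]].
  apply/setP => c; rewrite !inE /E' -andbA; congr (_ && _).
  apply/forall_inP/andP => [H|[H1 /forall_inP H2] x xS].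
    by split; [exact: H | apply/forall_inP => x /setD1P[_ /H]].
  by case: (eqVneq x t) => [->|xt] //; apply: H2; apply/setD1P.
rewrite (IH E'); first last.
- move=> c c' H; have Ht : c t = c' t by apply: H; rewrite !inE eqxx.
  rewrite /E' Ht (indE c c') // => x; rewrite inE => xS.
  by apply: H; rewrite !inE negb_and xS orbT.
- by move: cardS; rewrite (cardsD1 t) tS => -[].
have indt : independent_of [set t] E.
  move=> c c' H; apply: indE => x xS; apply: H; move: xS; rewrite !inE.
  by apply: contraNN => /eqP ->.
rewrite exprSr -mulrA; congr (_ * _); rewrite /q.
have e1 := card_colour_at v indt.
have e2 : (#|[set c : {ffun T -> 'I_k} | E c & c t == v]| + #|[set c | E' c]| =
           #|[set c | E c]|)%N.
  rewrite -(cardsID [set c : {ffun T -> 'I_k} | c t == v] [set c | E c]); congr (_ + _)%N;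
  by apply: eq_card => c; rewrite !inE // andbC.
have k0 : k%:R != 0 :> R by rewrite pnatr_eq0 -lt0n.
move/(congr1 (fun n => n%:R : R)): e2; rewrite natrD => /eqP.
rewrite addrC eq_sym -subr_eq => /eqP <-; rewrite -e1 natrM.
by field.
Qed.

(** Disjoint blocks are coloured independently, and a block of at most m points
    misses the colour v with probability at least q ^+ m. *)
Lemma card_hit_blocks (s : seq {set T}) v m : (0 < k)%N ->
    pairwise (fun A B : {set T} => [disjoint A & B]) s -> all (fun A => #|A| <= m)%N s ->
  #|[set c : {ffun T -> 'I_k} | all (fun A => [exists t in A, c t == v]) s]|%:R
    <= (1 - q ^+ m) ^+ size s * (k ^ #|T|)%:R :> R.
Proof.
move=> k_gt0; have q_ge0 : 0 <= q by rewrite subr_ge0 invf_le1 ?ler1n ?ltr0n.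
have q_le1 : q <= 1 by rewrite gerBl invr_ge0 ler0n.
elim: s => [|A s IH] /=.
  move=> _ _; rewrite expr0 mul1r ler_nat -[k in leqRHS]card_ord -card_ffun.
  exact: max_card.
case/andP=> disjA disjs /andP[cardA cards].
pose E c := all (fun B : {set T} => [exists t in B, c t == v]) s.
have indE : independent_of A E.
  move=> c c' eqc; apply: eq_in_all => B Bs; apply: eq_existsb => t.
  case tB: (t \in B) => //=; rewrite eqc // inE.
  by rewrite (disjointFl (allP disjA B Bs)).
have split_hit : (#|[set c : {ffun T -> 'I_k} | [exists t in A, c t == v] && E c]| +
    #|[set c | E c & [forall t in A, c t != v]]| = #|[set c | E c]|)%N.
  rewrite -(cardsID [set c : {ffun T -> 'I_k} | [exists t in A, c t == v]] [set c | E c]).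
  congr (_ + _)%N; apply: eq_card => c; rewrite !inE /= ?[E c && _]andbC //.
  by rewrite negb_exists; congr (_ && _); apply: eq_forallb => t; rewrite negb_and implybE.
have := congr1 (fun n => n%:R : R) split_hit.
rewrite natrD (card_avoid _ k_gt0 indE) => /eqP.
rewrite eq_sym -subr_eq => /eqP <-; rewrite -[X in X - _]mul1r -mulrBl.
rewrite exprS -mulrA; apply: ler_pM; rewrite ?ler0n //.
- by rewrite subr_ge0 exprn_ile1.
- by rewrite lerD2l lerN2 ler_wiXn2l.
- exact: IH.
Qed.
End Colourings.

Definition translates_cover (T : finType) m (g : 'I_m -> {perm T}) (A : {set T}) :=
  [forall x, exists j, ((g j)^-1)%g x \in A].

(** The number r of independent events is the size of a maximal set X of points
    with pairwise disjoint blocks F x = {g_j^-1 x}. If the block of y meets the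
    block of a member x of X, then y = g_i (g_j^-1 x) for some i and j, whence
    n <= r m^2. *)
Lemma card_colour_class_covers (R : realFieldType) (T : finType) k m
    (g : 'I_m -> {perm T}) (v : 'I_k) : (0 < m)%N ->
  exists2 r, (#|T| <= r * m ^ 2)%N &
    #|[set c : {ffun T -> 'I_k} | translates_cover g [set t | c t == v]]|%:R
      <= (1 - (1 - k%:R^-1) ^+ m) ^+ r * (k ^ #|T|)%:R :> R.
Proof.
move=> m_gt0; pose F x := [set ((g j)^-1)%g x | j : 'I_m].
pose P (X : {set T}) := [forall x in X, forall y in X, (x != y) ==> [disjoint F x & F y]].
have P0 : P (finset.set0 : {set T}) by apply/forall_inP => x; rewrite inE.
have [X maxX _] := maxset_exists P0.
have /forall_inP PX := maxsetp maxX.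
exists #|X|.
  have cov y : exists2 x, x \in X & ~~ [disjoint F x & F y].
    have Fnil (z : T) : ~~ [disjoint F z & F z].
      rewrite -setI_eq0 finset.setIid; apply/set0Pn.
      by exists ((g (Ordinal m_gt0))^-1%g z); apply: imset_f.
    case yX: (y \in X); first by exists y.
    apply/exists_inP; rewrite -[X in is_true X]negbK negb_exists_in.
    apply/negP => /forall_inP disj; move: yX => /negP; apply.
    have PyX : P (y |: X).
      apply/forall_inP => x xX; apply/forall_inP => z zX; apply/implyP => xz.
      case/setU1P: xX xz => [->|xX]; case/setU1P: zX => [->|zX] xz.
      - by rewrite eqxx in xz.
      - by rewrite disjoint_sym; have := disj z zX; rewrite negbK.
      - by have := disj x xX; rewrite negbK.
      - by have /forall_inP/(_ z zX)/implyP/(_ xz) := PX x xX.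
    have [_ /(_ _ PyX (finset.subsetUr _ _)) <-] := maxsetP maxX.
    exact: finset.setU11.
  (* Each point is of the form f (x, (i, j)) with x in X. *)
  pose f (p : T * ('I_m * 'I_m)) := g p.2.1 ((g p.2.2)^-1%g p.1).
  pose D := finset.setX X (finset.setX [set: 'I_m] [set: 'I_m]).
  have <- : #|D| = (#|X| * m ^ 2)%N by rewrite !cardsX !cardsT !card_ord mulnn.
  apply: leq_trans (leq_imset_card f D); rewrite -cardsT; apply: subset_leq_card.
  apply/fintype.subsetP => y _; have [x xX] := cov y.
  rewrite -setI_eq0 => /set0Pn[z /setIP[/imsetP[j _ zj] /imsetP[i _ zi]]].
  apply/imsetP; exists (x, (i, j)); first by rewrite !inE xX.
  by rewrite /f /= -zj zi permKV.
have Hs : pairwise (fun A B : {set T} => [disjoint A & B]) [seq F x | x <- enum X].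
  rewrite pairwise_map.
  have : uniq (enum X) by exact: enum_uniq.
  rewrite uniq_pairwise; apply: (@sub_in_pairwise _ (mem X)) => [x y xX yX /=|].
    by have /forall_inP/(_ y yX)/implyP := PX x xX.
  by apply/allP => x; rewrite mem_enum.
have Hm : all (fun A : {set T} => #|A| <= m)%N [seq F x | x <- enum X].
  by rewrite all_map; apply/allP => x _ /=; rewrite -[leqRHS]card_ord leq_imset_card.
have k_gt0 : (0 < k)%N by case: k v => [[]|].
have := @card_hit_blocks R T k _ v m k_gt0 Hs Hm.
rewrite size_map -cardE; apply: le_trans; rewrite ler_nat; apply: subset_leq_card.
apply/fintype.subsetP => c; rewrite !inE => cov; rewrite all_map; apply/allP => x _ /=.
have /existsP[j] := forallP cov x; rewrite inE => cj; apply/exists_inP.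
by exists ((g j)^-1%g x) => //; apply: imset_f.
Qed.

(** A union bound over the colours and the m-tuples of elements of G produces a
    colouring none of whose classes has m translates that cover; its largest
    class is A. Choosing a class of a colouring, rather than a random subset of
    density 1/k, spares a concentration estimate for the size of A. *)
Lemma exists_hard_to_cover (R : realFieldType) (T : finType) (G : {set {perm T}}) k m :
    (0 < k)%N -> (0 < m)%N ->
    (forall r, (#|T| <= r * m ^ 2)%N ->
       k%:R * #|G|%:R ^+ m * (1 - (1 - k%:R^-1) ^+ m) ^+ r < 1 :> R) ->
  exists2 A : {set T}, (#|T| <= k * #|A|)%N &
    forall g : 'I_m -> {perm T}, (forall j, g j \in G) -> ~~ translates_cover g A.
Proof.
move=> k_gt0 m_gt0 small.
pose class (c : {ffun T -> 'I_k}) v := [set t | c t == v].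
pose bad (p : {ffun 'I_m -> {perm T}} * 'I_k) :=
  [set c : {ffun T -> 'I_k} | translates_cover p.1 (class c p.2)].
pose D := finset.setX [set g : {ffun 'I_m -> {perm T}} | g \in ffun_on (mem G)] [set: 'I_k].
have cardD : #|D| = (#|G| ^ m * k)%N.
  rewrite cardsX cardsT card_ord; congr (_ * _)%N.
  by rewrite cardsE card_ffun_on card_ord.
have [c cbad] : exists c, c \notin \bigcup_(p in D) bad p.
  apply/existsP; rewrite -negb_forall; apply/negP => /forallP all_bad.
  have bad_small p : (#|D| * #|bad p| < k ^ #|T|)%N.
    have [r Tr bad_le] := card_colour_class_covers R p.1 p.2 m_gt0.
    rewrite -(ltr_nat R) cardD natrM (natrM _ (_ ^ _)) natrX [_ * k%:R]mulrC.
    apply: le_lt_trans (ler_wpM2l _ bad_le) _; first by rewrite mulr_ge0 ?exprn_ge0.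
    rewrite mulrA gtr_pMl ?small // ltr0n expn_gt0 k_gt0 //.
  have all_le : (k ^ #|T| <= \sum_(p in D) #|bad p|)%N.
    rewrite -[k in leqLHS]card_ord -card_ffun -sum1_card.
    under [leqRHS]eq_bigr do rewrite -sum1_card big_mkcond /=.
    rewrite exchange_big /=; apply: leq_sum => c _.
    have := all_bad c => /bigcupP[p pD cp].
    by rewrite (bigD1 p) //= cp.
  have D_gt0 : (0 < #|D|)%N.
    rewrite lt0n; apply: contraTneq all_le => /eqP; rewrite cards_eq0 => /eqP ->.
    by rewrite big_set0 -ltnNge expn_gt0 k_gt0.
  have : (\sum_(p in D) (#|D| * #|bad p|).+1 <= \sum_(p in D) k ^ #|T|)%N.
    by apply: leq_sum => p _; exact: bad_small.
  rewrite sum_nat_const leqNgt => /negP; apply.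
  apply: (@leq_ltn_trans (\sum_(p in D) #|D| * #|bad p|)).
    by rewrite -big_distrr leq_mul2l all_le orbT.
  under [ltnRHS]eq_bigr do rewrite -addn1.
  by rewrite big_split /= sum1_card -[ltnLHS]addn0 ltn_add2l.
have [v vbig] : exists v, (#|T| <= k * #|class c v|)%N.
  apply/existsP; rewrite -[[exists _, _]]negbK negb_exists; apply/negP => /forallP small_cl.
  have class_sum : (\sum_v #|class c v| = #|T|)%N.
    rewrite -[RHS]sum1_card (partition_big c xpredT) //=.
    by apply: eq_bigr => v _; rewrite -sum1_card; apply: eq_bigl => t; rewrite !inE.
  have : (\sum_v (k * #|class c v|).+1 <= \sum_(v < k) #|T|)%N.
    by apply: leq_sum => v _; rewrite ltnNge.
  rewrite sum_nat_const card_ord leqNgt => /negP; apply.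
  rewrite -[in ltnLHS]class_sum big_distrr /=.
  under [ltnRHS]eq_bigr do rewrite -addn1.
  by rewrite big_split /= sum1_card card_ord -[ltnLHS]addn0 ltn_add2l.
exists (class c v) => // g gG; apply: contraNN cbad => cov.
apply/bigcupP; exists ([ffun j => g j], v).
  by rewrite !inE andbT; apply/ffun_onP => j; rewrite ffunE.
rewrite inE; apply/forallP => x; have /existsP[j jx] := forallP cov x; apply/existsP.
by exists j; rewrite /= ffunE.
Qed.

(** * Hermitian geometry of function spaces *)

(** The counterpart of [permmod] over an abstract field: the Hermitian geometry
    needs no more than complex conjugation. *)
Definition funspace (C : numClosedFieldType) (T : finType) : vectType C :=
  {ffun T -> C^o}.

Section Hermitian.
Variables (C : numClosedFieldType) (T : finType).
Local Notation F := (funspace C T).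
Implicit Types (f g u v : F) (U V W : {vspace F}).

Definition herm f g : C := \sum_x (f x : C) * (g x : C)^*.

(** [herm] is linear in its first argument only; naming the partial application
    lets it carry a linear structure. *)
Definition hermr g f : C^o := herm f g.

Lemma hermr_is_linear g : linear (hermr g).
Proof.
move=> a f f'; rewrite /hermr /herm scaler_sumr -big_split /=; apply: eq_bigr => x _.
by rewrite !ffunE mulrDl /= -mulrA.
Qed.
HB.instance Definition _ g := GRing.isLinear.Build C F C^o *:%R
  (hermr g) (hermr_is_linear g).

Lemma conj_mulC (a b : C) : (a * b^* )^* = b * a^*.
Proof. by rewrite rmorphM /= conjCK mulrC. Qed.

Lemma hermC f g : herm g f = (herm f g)^*.
Proof. rewrite /herm rmorph_sum; apply: eq_bigr => x _; exact/esym/conj_mulC. Qed.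

Lemma herm_suml (I : finType) (v : I -> F) g :
  herm (\sum_i v i) g = \sum_i herm (v i) g.
Proof. exact: (linear_sum (hermr g)). Qed.

Lemma hermZl a f g : herm (a *: f) g = a * herm f g.
Proof. exact: (linearZ_LR (hermr g)). Qed.

Lemma herm_ge0 f : 0 <= herm f f.
Proof. by apply: sumr_ge0 => x _; rewrite -normCK exprn_ge0. Qed.

Lemma herm_eq0 f : (herm f f == 0) = (f == 0).
Proof.
apply/eqP/eqP => [/psumr_eq0P h0|->]; last first.
  by rewrite /herm big1 // => x _; rewrite ffunE mul0r.
apply/ffunP => x; rewrite ffunE; apply/eqP; rewrite -normr_eq0 -sqrf_eq0 normCK.
by apply/eqP; apply: h0 => // y _; rewrite -normCK exprn_ge0.
Qed.

Definition orthonormal_basis U d (e : 'I_d -> F) :=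
  [/\ forall i, e i \in U, forall i j, herm (e i) (e j) = (i == j)%:R &
      forall f, f \in U -> f = \sum_i herm f (e i) *: e i].

Lemma hermBl f f' g : herm (f - f') g = herm f g - herm f' g.
Proof. exact: (linearB (hermr g)). Qed.

Lemma hermZr a f g : herm f (a *: g) = a^* * herm f g.
Proof. by rewrite hermC hermZl rmorphM /= -hermC. Qed.

Lemma hermBr f f' g : herm g (f - f') = herm g f - herm g f'.
Proof. by rewrite hermC hermBl rmorphB /= -!hermC. Qed.

Lemma herm_sumr (I : finType) (v : I -> F) g :
  herm g (\sum_i v i) = \sum_i herm g (v i).
Proof.
by rewrite hermC herm_suml rmorph_sum; apply: eq_bigr => i _; rewrite /= -hermC.
Qed.

(** Induction on the dimension: normalise a nonzero vector v of U and add to it an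
    orthonormal basis of the orthogonal complement U' of v in U. *)
Lemma orthonormal_basis_exists U : exists e, @orthonormal_basis U (\dim U) e.
Proof.
move Hd : (\dim U) => d; elim: d U Hd => [|d IH] U dimU.
  exists (fun _ => 0); split=> [i|i|f]; try by case: i.
  by move/eqP: dimU; rewrite dimv_eq0 => /eqP ->; rewrite memv0 big_ord0 => /eqP.
pose w := vpick U.
have w0 : w != 0 by rewrite vpick0 -dimv_eq0 dimU.
have ww0 : 0 < herm w w by rewrite lt0r herm_eq0 w0 herm_ge0.
pose s := sqrtC (herm w w); have s0 : 0 < s by rewrite sqrtC_gt0.
pose v := s^-1 *: w.
have vU : v \in U by rewrite memvZ // memv_pick.
have vv : herm v v = 1.
  rewrite hermZl hermZr geC0_conj ?invr_ge0 ?ltW // mulrA -invfM -expr2 sqrtCK.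
  by rewrite mulVf // gt_eqF.
pose U' := (U :&: lker (linfun (hermr v)))%VS.
have inU' f : (f \in U') = (f \in U) && (herm f v == 0).
  by rewrite memv_cap memv_ker lfunE.
have vU' : v \notin U' by rewrite inU' vv oner_eq0 andbF.
have sub f : f \in U -> f - herm f v *: v \in U'.
  by move=> fU; rewrite inU' memvB ?memvZ ?memv_pick // hermBl hermZl vv mulr1 subrr eqxx.
have dimU' : \dim U' = d.
  have lt_dim : (\dim U' < d.+1)%N.
    rewrite -dimU ltn_neqAle dimvS ?capvSl // andbT; apply: contra vU' => /eqP eq_dim.
    have /eqP -> : U' == U by rewrite eqEdim capvSl eq_dim leqnn.
    exact: vU.
  have le1 : (\dim (linfun (hermr v) @: U) <= 1)%N.
    by rewrite (leq_trans (dimvS (subvf _))) // dimvf.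
  apply/eqP; rewrite eqn_leq -ltnS lt_dim /= -ltnS -dimU.
  by rewrite -(limg_ker_dim (linfun (hermr v)) U) -addn1 leq_add2l.
have [e [eU' eo eb]] := IH U' dimU'.
exists (fun i : 'I_d.+1 => if unlift ord0 i is Some j then e j else v).
have ev j : herm (e j) v = 0 by have := eU' j; rewrite inU' => /andP[_ /eqP].
have ve j : herm v (e j) = 0 by rewrite hermC ev rmorph0.
split=> [i|i j|f fU].
- by case: unliftP => // j _; have := eU' j; rewrite inU' => /andP[].
- case: unliftP => [i' ->|->]; case: unliftP => [j' ->|->] //.
- rewrite big_ord_recl unlift_none -[LHS](subrK (herm f v *: v)) addrC; congr (_ + _).
  rewrite [LHS](eb _ (sub f fU)); apply: eq_bigr => i _; rewrite liftK.
  by rewrite hermBl hermZl ve mulr0 subr0.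
Qed.

Lemma parseval U d (e : 'I_d -> F) f : orthonormal_basis U e -> f \in U ->
  herm f f = \sum_i `|herm f (e i)| ^+ 2.
Proof.
move=> [_ _ eb] /eb fE; rewrite [X in herm X _]fE herm_suml; apply: eq_bigr => i _.
by rewrite hermZl normCK [herm (e i) f]hermC.
Qed.

Definition orthoproj d (e : 'I_d -> F) f : F := \sum_i herm f (e i) *: e i.

Lemma memv_orthoproj U d (e : 'I_d -> F) f : orthonormal_basis U e ->
  orthoproj e f \in U.
Proof. by move=> [eU _ _]; apply: memv_suml => i _; rewrite memvZ. Qed.

Lemma herm_orthoproj U d (e : 'I_d -> F) f w : orthonormal_basis U e -> w \in U ->
  herm (orthoproj e f) w = herm f w.
Proof.
move=> [_ _ eb] /eb wE; rewrite [in RHS]wE herm_suml herm_sumr; apply: eq_bigr => i _.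
by rewrite hermZl hermZr -hermC mulrC.
Qed.

Lemma herm_orthoproj_self U d (e : 'I_d -> F) f : orthonormal_basis U e ->
  herm (orthoproj e f) (orthoproj e f) = \sum_i `|herm f (e i)| ^+ 2.
Proof.
move=> eU; have [eU' _ _] := eU; rewrite (parseval eU (memv_orthoproj f eU)).
by apply: eq_bigr => i _; rewrite (herm_orthoproj f eU).
Qed.

Lemma bessel U d (e : 'I_d -> F) f : orthonormal_basis U e ->
  \sum_i `|herm f (e i)| ^+ 2 <= herm f f.
Proof.
move=> eU; rewrite -(herm_orthoproj_self f eU); set p := orthoproj e f.
have fp : herm f p = herm p p by rewrite -(herm_orthoproj f eU) ?(memv_orthoproj _ eU).
have pf : herm p f = herm p p by rewrite hermC fp -hermC.
by have := herm_ge0 (f - p); rewrite hermBl !hermBr fp pf subrr subr0 subr_ge0.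
Qed.

(** Let e be an orthonormal basis of U :&: W. By Parseval in U, the dimension is
    the sum over i and l of |<a_i, e_l>|^2. For fixed i, the sum over l is the
    squared length of the projection of a_i to U :&: W, which is at most that
    of its projection to the larger space W. *)
Lemma dim_cap_le U W d k (a : 'I_d -> F) (b : 'I_k -> F) :
    orthonormal_basis U a -> orthonormal_basis W b ->
  (\dim (U :&: W))%:R <= \sum_i \sum_j `|herm (a i) (b j)| ^+ 2.
Proof.
move=> aU bW; have [e eUW] := orthonormal_basis_exists (U :&: W); have [eE eo _] := eUW.
have -> : (\dim (U :&: W))%:R = \sum_i \sum_l `|herm (a i) (e l)| ^+ 2.
  rewrite exchange_big /= -[in LHS](card_ord (\dim (U :&: W))) -sumr_const.
  apply: eq_bigr => l _; transitivity (herm (e l) (e l)); first by rewrite eo eqxx.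
  have elU : e l \in U by have := eE l; rewrite memv_cap => /andP[].
  rewrite (parseval aU elU); apply: eq_bigr => i _.
  by rewrite [herm (a i) _]hermC norm_conjC.
apply: ler_sum => i _; rewrite -(herm_orthoproj_self (a i) bW).
rewrite (eq_bigr (fun l => `|herm (orthoproj b (a i)) (e l)| ^+ 2)); first exact: bessel eUW.
by move=> l _; rewrite (herm_orthoproj _ bW) //; have := eE l; rewrite memv_cap => /andP[].
Qed.
End Hermitian.

(** * Averaging over a 2-transitive group *)

Lemma two_transitive_move (T : finType) (G : {group {perm T}}) (x y u v : T) :
    [transitive^2 G, on [set: T] | 'P] -> x != y -> u != v ->
  exists2 h, h \in G & h x = u /\ h y = v.
Proof.
move=> tG xy uv.
have dt (a b : T) : a != b -> [tuple a; b] \in 2.-dtuple([set: T]).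
  by move=> ab; rewrite inE /= !inE ab /=; apply/fintype.subsetP => z _; rewrite inE.
have [h hG /(congr1 val) /= [] -> ->] := atransP2 tG (dt x y xy) (dt u v uv).
by exists h.
Qed.

(** Expanding the squares gives the form with kernel
    K x y = \sum_(s in G) a (s^-1 x) * (a (s^-1 y))^*. It is G-invariant, so
    2-transitivity makes it constant off the diagonal (beta) and on it (alpha).
    The form then takes the value (alpha - beta) |b|^2 at the sum-zero vector b,
    and alpha and beta are found from the row sums of K, which vanish because a
    has sum zero, and from its trace |G| |a|^2. *)
Lemma sum_sq_inner_translates (C : numClosedFieldType) (T : finType)
    (G : {group {perm T}}) (a b : T -> C) :
    (1 < #|T|)%N -> [transitive^2 G, on [set: T] | 'P] ->
    \sum_x a x = 0 -> \sum_x b x = 0 ->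
  #|T|.-1%:R * \sum_(s in G) `|\sum_x a (s^-1%g x) * (b x)^*| ^+ 2 =
  #|G|%:R * (\sum_x a x * (a x)^*) * (\sum_x b x * (b x)^*).
Proof.
move=> T_gt1 tG a0 b0; set na := \sum_x a x * (a x)^*; set nb := \sum_x b x * (b x)^*.
pose K x y := \sum_(s in G) a (s^-1%g x) * (a (s^-1%g y))^*.
have K_inv h x y : h \in G -> K (h x) (h y) = K x y.
  move=> hG; rewrite /K (reindex_inj (mulIg h)) /=.
  by apply: eq_big => s; rewrite ?groupMr // => _; rewrite invMg !permM !permK.
have [x0 [y0 xy0]] : exists x0 y0 : T, x0 != y0.
  by have /card_gt1P[x [y [_ _ xy]]] := T_gt1; exists x, y.
pose alpha := K x0 x0; pose beta := K x0 y0.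
have Koff x y : x != y -> K x y = beta.
  by move=> xy; have [h hG [<- <-]] := two_transitive_move tG xy0 xy; rewrite K_inv.
have Kdiag x : K x x = alpha.
  have [->//|xx0] := eqVneq x x0.
  by have [h hG [<- _]] := two_transitive_move tG xy0 xx0; rewrite K_inv.
have KE x y : K x y = beta + (x == y)%:R * (alpha - beta).
  by case: eqVneq => [->|/Koff->]; rewrite ?Kdiag /=; ring.
have sum_act (f : T -> C) (s : {perm T}) : \sum_x f (s^-1%g x) = \sum_x f x.
  by rewrite [RHS](reindex_inj (@perm_inj _ s^-1%g)).
have row0 : #|T|%:R * beta + (alpha - beta) = 0.
  transitivity (\sum_y K x0 y).
    under eq_bigr do rewrite KE; rewrite big_split /= sumr_const mulr_natl; congr (_ + _).
    rewrite (bigD1 x0) //= eqxx mul1r big1 ?addr0 // => y /negPf; rewrite eq_sym => ->.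
    by rewrite mul0r.
  rewrite exchange_big big1 // => s _; rewrite -mulr_sumr -rmorph_sum.
  by rewrite (sum_act a s) a0 rmorph0 mulr0.
have diag : #|T|%:R * alpha = #|G|%:R * na.
  transitivity (\sum_x K x x).
    by under [RHS]eq_bigr do rewrite Kdiag; rewrite sumr_const mulr_natl.
  rewrite exchange_big /=; under eq_bigr => s _ do rewrite (sum_act (fun x => a x * (a x)^*)).
  by rewrite sumr_const mulr_natl.
have -> : \sum_(s in G) `|\sum_x a (s^-1%g x) * (b x)^*| ^+ 2 = (alpha - beta) * nb.
  transitivity (\sum_x \sum_y (b x)^* * b y * K x y).
    under eq_bigr => s _ do rewrite normCK rmorph_sum mulr_suml.
    rewrite exchange_big; apply: eq_bigr => x _.
    under eq_bigr => s _ do rewrite mulr_sumr.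
    rewrite exchange_big; apply: eq_bigr => y _; rewrite mulr_sumr; apply: eq_bigr => s _.
    by rewrite rmorphM /= conjCK; ring.
  rewrite mulr_sumr; apply: eq_bigr => x _.
  transitivity ((b x)^* * (beta * \sum_y b y + b x * (alpha - beta))); last by rewrite b0; ring.
  rewrite -[X in _ = _ * (_ + X)]mul1r mulrDr mulr_sumr mulr_sumr.
  under eq_bigr do rewrite KE mulrDr.
  rewrite big_split /=; congr (_ + _); first by apply: eq_bigr => y _; ring.
  rewrite (bigD1 x) //= eqxx big1 ?addr0 => [|y]; first by rewrite /=; ring.
  by move/negPf; rewrite eq_sym => -> /=; ring.
have nT : #|T|%:R = #|T|.-1%:R + 1 :> C by rewrite natr1 prednK // ltnW.
rewrite -diag nT mulrA; congr (_ * _); move: row0; rewrite nT => row0.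
have -> : alpha = - #|T|.-1%:R * beta.
  by apply/eqP; rewrite mulNr -addr_eq0 -row0; apply/eqP; ring.
ring.
Qed.

Section DeletedModule.
Variables (R : realType) (T : finType) (G : {group {perm T}}).
Hypotheses (T_gt1 : (1 < #|T|)%N) (tG : [transitive^2 G, on [set: T] | 'P]).

Local Notation M := (permmod R T).
Local Notation V := (deleted_module R T).
Local Notation act := (@permmod_action R T).
Implicit Types (U W : {vspace M}).

Lemma herm_act (s : {perm T}) (f g : M) :
  herm (act s f : funspace R[i] T) (act s g) = herm (f : funspace R[i] T) g.
Proof.
rewrite /herm [RHS](reindex_inj (@perm_inj _ s^-1%g)) /=.
by apply: eq_bigr => x _; rewrite !permmod_actionE.
Qed.

Lemma orthonormal_basis_act s U d (e : 'I_d -> M) :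
  orthonormal_basis (U : {vspace funspace R[i] T}) (e : 'I_d -> funspace R[i] T) ->
  @orthonormal_basis R[i] T (act s @: U)%VS d (fun i => act s (e i)).
Proof.
move=> [eU eo eb]; split=> [i|i j|f].
- exact: memv_img.
- by rewrite herm_act.
- move=> /memv_imgP[u uU ->]; rewrite [in LHS](eb u uU) linear_sum.
  by apply: eq_bigr => i _; rewrite linearZ /= herm_act.
Qed.

Lemma limg_act_deleted s U : (U <= V)%VS -> (act s @: U <= V)%VS.
Proof. by move=> UV; rewrite -(permmod_action_deleted R s) limgS. Qed.

(** The average over G of the bound of [dim_cap_le] for the translates of an
    orthonormal basis of U is dim U dim W / N, so some translate does not exceed
    it. *)
Lemma exists_translate_small_cap U W : (U <= V)%VS -> (W <= V)%VS ->
  exists2 s, s \in G & (#|T|.-1 * \dim (act s @: U :&: W) <= \dim U * \dim W)%N.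
Proof.
move=> UV WV.
have [a aU] := @orthonormal_basis_exists R[i] T U.
have [b bW] := @orthonormal_basis_exists R[i] T W.
apply/exists_inP; rewrite -[X in is_true X]negbK negb_exists_in.
apply/negP => /forall_inP big_cap.
have sum0 (f : M) : f \in V -> \sum_x f x = 0.
  by rewrite mem_deleted_module => /eqP.
have avg : #|T|.-1%:R * \sum_(s in G) \sum_i \sum_j
    `|herm (act s (a i) : funspace R[i] T) (b j)| ^+ 2 = (#|G| * (\dim U * \dim W))%:R :> R[i].
  have term i j : #|T|.-1%:R * \sum_(s in G)
      `|herm (act s (a i) : funspace R[i] T) (b j)| ^+ 2 = #|G|%:R :> R[i].
    have [aU' ao _] := aU; have [bW' bo _] := bW.
    transitivity (#|G|%:R * herm (a i) (a i) * herm (b j) (b j)); last first.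
      by rewrite ao bo !eqxx !mulr1.
    rewrite /herm -(@sum_sq_inner_translates R[i] T G (a i) (b j)) //.
    - congr (_ * _); apply: eq_bigr => s _; congr (`|_| ^+ 2).
      by apply: eq_bigr => x _; rewrite permmod_actionE.
    - by apply: sum0; rewrite (subvP UV) ?aU'.
    - by apply: sum0; rewrite (subvP WV) ?bW'.
  rewrite exchange_big mulr_sumr /= (eq_bigr (fun=> #|G|%:R * (\dim W)%:R)) => [|i _].
    by rewrite sumr_const card_ord -[LHS]mulr_natl !natrM mulrCA.
  rewrite exchange_big mulr_sumr /= (eq_bigr (fun=> #|G|%:R)) => [|j _]; last exact: term.
  by rewrite sumr_const card_ord mulr_natr.
have : ((\sum_(s in G) (\dim U * \dim W).+1)%:R : R[i]) <= (#|G| * (\dim U * \dim W))%:R.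
  rewrite -avg natr_sum mulr_sumr; apply: ler_sum => s sG.
  apply: le_trans (_ : (#|T|.-1 * \dim (act s @: U :&: W))%:R <= _).
    by rewrite ler_nat ltnNge big_cap.
  rewrite natrM ler_wpM2l //; apply: dim_cap_le => //; exact: orthonormal_basis_act.
rewrite ler_nat sum_nat_const leq_mul2l ltnn orbF => /eqP G0.
by have := cardG_gt0 G; rewrite G0.
Qed.

(** By [exists_translate_small_cap], a suitable further translate multiplies the
    codimension by at most 1 - dim U / N; the powers of N clear denominators. *)
Lemma greedy_translates U m : (U <= V)%VS ->
  exists g : 'I_m -> {perm T}, [/\ forall j, g j \in G,
    (\sum_(j < m) (act (g j) @: U) <= V)%VS &
    (#|T|.-1 ^ m * (#|T|.-1 - \dim (\sum_(j < m) (act (g j) @: U))) <=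
       #|T|.-1 * (#|T|.-1 - \dim U) ^ m)%N].
Proof.
move=> UV; set N := #|T|.-1; elim: m => [|m [g [gG gV g_le]]].
  exists (fun _ => 1%g); split=> [j|/=|]; rewrite ?group1 ?big_ord0 ?sub0v //.
  by rewrite dimv0 subn0 !expn0 mul1n muln1.
set W := (\sum_(j < m) _)%VS in gV g_le.
have [s sG s_le] := exists_translate_small_cap UV gV.
exists (fun j => if unlift ord_max j is Some i then g i else s).
have -> : (\sum_(j < m.+1)
    (act (if unlift ord_max j is Some i then g i else s) @: U) = act s @: U + W)%VS.
  rewrite big_ord_recr /= unlift_none addvC; congr (_ + _)%VS.
  apply: eq_bigr => j _; suff -> : widen_ord (leqnSn m) j = lift ord_max j by rewrite liftK.
  by apply: val_inj; rewrite /= /bump leqNgt ltn_ord.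
have sWV : (act s @: U + W <= V)%VS by rewrite subv_add limg_act_deleted.
split=> // [j|]; first by case: unliftP.
have dimsU : \dim (act s @: U) = \dim U.
  apply: limg_dim_eq; apply/eqP; rewrite -subv0; apply/subvP => f.
  rewrite memv_cap memv_ker => /andP[_ /eqP f0].
  rewrite memv0 -(id_lfunE f) -(permmod_action1 R T) -(mulgV s) permmod_actionM.
  by rewrite comp_lfunE f0 linear0.
have dimV : \dim V = N := dim_deleted_module R T.
have := dimv_sum_cap (act s @: U) W; rewrite dimsU => dim_cap.
have leU : (\dim U <= N)%N by rewrite -dimV dimvS.
have leW : (\dim W <= N)%N by rewrite -dimV dimvS.
have leS : (\dim (act s @: U + W) <= N)%N by rewrite -dimV dimvS.
have step : (N * (N - \dim (act s @: U + W)) <= (N - \dim W) * (N - \dim U))%N.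
  rewrite mulnBr; move: s_le leS; rewrite -/N; nia.
rewrite expnSr -mulnA; apply: leq_trans (leq_mul (leqnn _) step) _.
by rewrite mulnA expnSr mulnA leq_mul.
Qed.
End DeletedModule.

(** * The upper bound *)

Section UpperBound.
Variables (R : realType) (T : finType) (G : {group {perm T}}).
Hypotheses (T_gt1 : (1 < #|T|)%N) (tG : [transitive^2 G, on [set: T] | 'P]).
Local Notation N := #|T|.-1.
Local Notation M := (permmod R T).
Local Notation V := (deleted_module R T).
Local Notation act := (@permmod_action R T).
Implicit Types (U : {vspace M}).

(** Since (1 - dim U / N) ^+ m <= exp (- m dim U / N), the codimension left by the
    greedy choice is below 1 as soon as m exceeds (N / dim U) ln N. *)
Lemma exists_few_translates U : U != 0%VS -> (U <= V)%VS ->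
  exists2 m, translates_span act G V U m &
    m%:R <= N%:R / (\dim U)%:R * ln (N%:R : R) + 1.
Proof.
move=> U0 UV.
have N_gt0 : (0 < N)%N by case: #|T| T_gt1 => [|[]].
have d_gt0 : (0 < \dim U)%N by rewrite lt0n dimv_eq0.
have dN : (\dim U <= N)%N by rewrite -(dim_deleted_module R) dimvS.
set L := ln (N%:R : R); have L_ge0 : 0 <= L by rewrite ln_ge0 ?ler1n.
set x : R := N%:R / (\dim U)%:R.
have x_gt0 : 0 < x by rewrite divr_gt0 ?ltr0n.
have xL : 0 <= x * L by rewrite mulr_ge0 // ltW.
pose m := (Num.truncn (x * L)).+1.
have m_gt : x * L < m%:R by rewrite truncnS_gt.
exists m; last first.
  by rewrite -natr1 lerD2r truncn_le.
have [g [gG gV g_le]] := greedy_translates T_gt1 tG m UV.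
exists g; split=> //; apply/eqP; rewrite eqEdim gV (dim_deleted_module R) -subn_eq0 /=.
set c := (N - _)%N in g_le *.
have small : (N * (N - \dim U) ^ m < N ^ m)%N.
  rewrite -(ltr_nat R) natrM !natrX natrB //.
  have NR0 : 0 < N%:R :> R by rewrite ltr0n.
  have -> : N%:R - (\dim U)%:R = N%:R * (1 - x^-1) :> R.
    by rewrite /x; field; rewrite !pnatr_eq0 -!lt0n d_gt0 N_gt0.
  rewrite exprMn mulrCA gtr_pMr ?exprn_gt0 //.
  have x1 : x^-1 <= 1 by rewrite invf_le1 // ler_pdivlMr ?ltr0n // mul1r ler_nat.
  apply: (@le_lt_trans _ _ (N%:R * expR (- x^-1) ^+ m)).
    by rewrite ler_pM2l // lerXn2r ?nnegrE ?expR_ge0 ?subr_ge0 // expR_ge1Dx.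
  rewrite -expRM_natr -[X in X * _](@lnK R) ?posrE // -expRD expR_lt1 mulNr subr_lt0.
  by rewrite -ltr_pdivrMl ?invr_gt0 // invrK.
apply: contraLR small; rewrite -leqNgt -lt0n => c_gt0; apply: leq_trans g_le.
exact: leq_pmulr.
Qed.

(** If x = N / dim U >= 1 and c >= x is its ceiling, then m <= x ln N + 1 gives
    m <= (1 + ln N) c. *)
Lemma covering_complexity_le :
  (covering_complexity act G V <= (1 + ln (N%:R : R))%:E)%E.
Proof.
apply: ge_ereal_sup => _ [U [U0 UV] <-].
have [m mP m_le] := exists_few_translates U0 UV.
have N_gt0 : (0 < N)%N by case: #|T| T_gt1 => [|[]].
have d_gt0 : (0 < \dim U)%N by rewrite lt0n dimv_eq0.
have dN : (\dim U <= N)%N by rewrite -(dim_deleted_module R) dimvS.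
rewrite /diam_ratio dim_deleted_module; set x : R := N%:R / (\dim U)%:R in m_le *.
set L := ln _ in m_le *; have L_ge0 : 0 <= L by rewrite ln_ge0 ?ler1n.
have x1 : 1 <= x by rewrite ler_pdivlMr ?ltr0n // mul1r ler_nat.
have x_ceil : x <= (Num.ceil x)%:~R by exact: ceil_ge.
have c_gt0 : 0 < (Num.ceil x)%:~R :> R by apply: lt_le_trans x_ceil; lra.
apply: (@le_trans _ _ (m%:R%:E * ((Num.ceil x)%:~R^-1)%:E)%E).
  by apply: lee_wpmul2r; [rewrite lee_fin invr_ge0 ltW | apply: ereal_inf_lbound; exists m].
rewrite -EFinM lee_fin ler_pdivrMr // (le_trans m_le) // mulrDl mul1r addrC.
by rewrite lerD // ?(le_trans x1) // mulrC ler_wpM2l.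
Qed.
End UpperBound.

(** * The lower bound *)

Definition restrict_off (R : realType) (T : finType) (A : {set T})
    (f : permmod R T) : permmod R {x : T | x \notin A} :=
  [ffun x => f (val x)].

Lemma restrict_off_is_linear (R : realType) (T : finType) (A : {set T}) :
  linear (@restrict_off R T A).
Proof. by move=> a f g; apply/ffunP => w; rewrite !ffunE. Qed.

HB.instance Definition _ (R : realType) (T : finType) (A : {set T}) :=
  GRing.isLinear.Build R[i] (permmod R T) (permmod R {x : T | x \notin A}) *:%R
    (@restrict_off R T A) (@restrict_off_is_linear R T A).

Section LowerBound.
Variables (R : realType) (T : finType) (G : {group {perm T}}).
Hypotheses (T_gt1 : (1 < #|T|)%N).
Local Notation N := #|T|.-1.
Local Notation M := (permmod R T).
Local Notation V := (deleted_module R T).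
Local Notation act := (@permmod_action R T).

Definition supported_in (A : {set T}) : {vspace M} :=
  (V :&: lker (linfun (@restrict_off R T A)))%VS.

Lemma supported_in_eq0 (A : {set T}) f x : f \in supported_in A -> x \notin A -> f x = 0.
Proof.
rewrite /supported_in memv_cap.
case/andP => _; rewrite memv_ker lfunE => /eqP/ffunP f0 xA.
by have := f0 (Sub x xA); rewrite !ffunE.
Qed.

(** The restriction to the complement of A has rank at most n - |A| on a space of
    dimension n - 1. *)
Lemma dim_supported_in (A : {set T}) : (#|A|.-1 <= \dim (supported_in A))%N.
Proof.
set d := \dim (supported_in A); set e := \dim (linfun (@restrict_off R T A) @: V).
have de : (d + e = N)%N.
  by rewrite -(dim_deleted_module R T) -(limg_ker_dim (linfun (@restrict_off R T A))).
have e_le : (e <= #|T| - #|A|)%N.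
  apply: leq_trans (dimvS (subvf _)) _.
  rewrite dimvf /dim /= muln1 card_sig -(cardC (mem A)) addKn; apply: eq_leq; exact: eq_card.
have A_le : (#|A| <= #|T|)%N := max_card _.
move: d e de e_le A_le T_gt1; set n := #|T|; set a := #|A|; lia.
Qed.

(** A point outside the translates of A is a common zero of the corresponding
    translates of the space, while f is a vector of V that does not vanish at
    it. *)
Lemma translates_cover_of_span (A : {set T}) m k : translates_span act G V (supported_in A) k ->
  (k <= m)%N -> exists2 g : 'I_m -> {perm T}, (forall j, g j \in G) & translates_cover g A.
Proof.
move=> [g [gG gV]] km.
exists (fun j => if insub (val j) is Some i then g i else 1%g) => [j|].
  by case: insub => [i|]; rewrite ?group1.
apply/forallP => x; apply/existsP.
suff [i iA] : exists i, ((g i)^-1)%g x \in A.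
  exists (widen_ord km i); rewrite /= insubT //= => lt_ik.
  by have -> : Sub (i : nat) lt_ik = i by exact: val_inj.
apply/existsP; rewrite -[X in is_true X]negbK negb_exists; apply/negP => /forallP off.
have [y yx] : exists y, y != x.
  have /card_gt1P[u [v [_ _ uv]]] := T_gt1.
  by case: (eqVneq u x) uv => [->|ux _]; [exists v; rewrite eq_sym | exists u].
pose f : M := [ffun z => (z == x)%:R - (z == y)%:R].
have fV : f \in V.
  have sum_delta (z : T) : \sum_w (w == z)%:R = 1 :> R[i].
    by rewrite (bigD1 z) //= eqxx big1 ?addr0 // => w /negPf ->.
  rewrite mem_deleted_module; apply/eqP; under eq_bigr do rewrite ffunE.
  have : \sum_w ((w == x)%:R - (w == y)%:R : R[i]) = 0 by rewrite sumrB !sum_delta subrr.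
  exact.
move: fV; rewrite -gV => /memv_sumP[w wP /(congr1 (fun h : M => h x))].
rewrite ffunE eqxx eq_sym (negPf yx) subr0 sum_ffunE big1 => [/eqP|i _].
  by rewrite oner_eq0.
have /memv_imgP[u uA ->] := wP i isT.
by rewrite permmod_actionE (supported_in_eq0 uA).
Qed.

(** The hypothesis [k ^ 2 <= #|T|] guarantees N <= (k + 1)(|A| - 1) for the set A
    of [exists_hard_to_cover], of size at least n/k. *)
Lemma covering_complexity_ge (k m : nat) :
    (1 < k)%N -> (0 < m)%N -> (k ^ 2 <= #|T|)%N ->
    (forall r, (#|T| <= r * m ^ 2)%N ->
       k%:R * #|G|%:R ^+ m * (1 - (1 - k%:R^-1) ^+ m) ^+ r < 1 :> R) ->
  (((m.+1)%:R / (k.+1)%:R)%:E <= covering_complexity act G V)%E.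
Proof.
move=> k_gt1 m_gt0 kT small.
have [A A_big A_hard] := exists_hard_to_cover (ltnW k_gt1) m_gt0 small.
have dA := dim_supported_in A.
have d_big : (N <= k.+1 * \dim (supported_in A))%N.
  apply: leq_trans (leq_mul (leqnn _) dA); rewrite -(leq_pmul2l (ltnW k_gt1)).
  have A_gt0 : (0 < #|A|)%N.
    by rewrite lt0n; apply: contraTneq A_big => ->; rewrite muln0 -ltnNge; lia.
  move: A_big kT; rewrite -(prednK A_gt0) /= => A_big kT; nia.
have d_gt0 : (0 < \dim (supported_in A))%N.
  by rewrite lt0n; apply: contraTneq d_big => ->; rewrite muln0 -ltnNge; lia.
apply: (@le_trans _ _ (diam_ratio act G V (supported_in A))); last first.
  apply: ereal_sup_ubound; exists (supported_in A) => //; split; last exact: capvSl.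
  by rewrite -dimv_eq0 -lt0n.
rewrite /diam_ratio dim_deleted_module; set x : R := N%:R / _.
have x_gt0 : 0 < x by rewrite divr_gt0 ?ltr0n //; lia.
have c_gt0 : 0 < (Num.ceil x)%:~R :> R by rewrite ltr0z ceil_gt0.
have c_le : (Num.ceil x)%:~R <= k.+1%:R :> R.
  rewrite -[leRHS]/(k.+1%:Z%:~R) ler_int ceil_le_int ler_pdivrMr ?ltr0n //.
  by rewrite -natrM ler_nat.
apply: (@le_trans _ _ ((m.+1)%:R%:E * ((Num.ceil x)%:~R^-1)%:E)%E).
  by rewrite -EFinM lee_fin ler_pM2l ?ltr0n // lef_pV2 ?posrE ?ltr0n.
apply: lee_wpmul2r; first by rewrite lee_fin invr_ge0 ltW.
apply: le_ereal_inf_tmp => _ [j jP <-]; rewrite lee_fin ler_nat ltnNge; apply/negP => jm.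
by have [g gG cov] := translates_cover_of_span jP jm; have := A_hard g gG; rewrite cov.
Qed.
End LowerBound.

(** * Asymptotics *)

(** Here y = n^(e/8), so that m <= k ln n <= K y and q >= n^(e-1) = y^8 / n for
    q = (1 - 1/k)^m. The left-hand side is at most exp (k + m y^4 - q r), and
    k + m y^4 >= q r would imply y^8 <= q n <= q r m^2 <= (k + m y^4) m^2 <=
    (K^2 k + K^3) y^7. *)
Lemma union_bound_lt1 (R : realType) (e : R) (n k g m r : nat) :
    0 < e < 1 -> (1 < k)%N -> (0 < n)%N -> (0 < g)%N ->
    let y := expR (e / 8 * ln (n%:R : R)) in
    let K := 8 * k%:R / e in
    K ^+ 2 * k%:R + K ^+ 3 < y ->
    ln (g%:R : R) <= y ^+ 4 ->
    m%:R <= (1 - e) * (k.-1%:R * ln (n%:R : R)) ->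
    (n <= r * m ^ 2)%N ->
  k%:R * g%:R ^+ m * (1 - (1 - k%:R^-1) ^+ m) ^+ r < 1 :> R.
Proof.
move=> /andP[e_gt0 e_lt1] k_gt1 n_gt0 g_gt0 y K y_big g_le m_le n_le.
set L := ln (n%:R : R) in y y_big g_le m_le.
have L_ge0 : 0 <= L by rewrite ln_ge0 // ler1n.
have nE : n%:R = y ^+ 8 * expR (- ((e - 1) * L)) :> R.
  rewrite /y -expRM_natr -expRD -[LHS]lnK ?posrE ?ltr0n //; congr expR.
  by rewrite -/L; field.
have k1 : 1 < k%:R :> R by rewrite ltr1n.
have kk : k%:R = k.-1%:R + 1 :> R by rewrite natr1 prednK // ltnW.
have kV_le1 : k%:R^-1 <= 1 :> R by rewrite invf_le1 ?(lt_trans _ k1) // ltW.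
have k'_gt0 : 0 < k.-1%:R :> R by rewrite kk in k1; lra.
have K_ge1 : 1 <= K by rewrite ler_pdivlMr //; lra.
have y_gt1 : 1 < y.
  apply: le_lt_trans y_big; apply: le_trans (_ : K ^+ 2 * k%:R <= _).
    exact: mulr_ege1 (exprn_ege1 _ K_ge1) (ltW k1).
  by rewrite lerDl exprn_ge0 // (le_trans _ K_ge1).
have y_gt0 : 0 < y by exact: expR_gt0.
have m_ge0 : 0 <= m%:R :> R by [].
have mKy : m%:R <= K * y.
  have : 1 + e / 8 * L <= y by exact: expR_ge1Dx.
  move=> Ly; apply: (@le_trans _ _ (k%:R * L)).
    apply: le_trans m_le _; rewrite kk -[leRHS]mul1r; apply: ler_pM => //; first by lra.
    - by rewrite mulr_ge0 // ltW.
    - by lra.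
    - by rewrite ler_wpM2r // lerDl.
  have -> : k%:R * L = K * (e / 8 * L) by rewrite /K; field; rewrite gt_eqF.
  by rewrite ler_wpM2l //; lra.
set q : R := (1 - k%:R^-1) ^+ m.
have q_ge : expR ((e - 1) * L) <= q.
  apply: (@le_trans _ _ (expR (- k.-1%:R^-1) ^+ m)).
    rewrite -expRM_natr ler_expR mulNr lerNr -mulNr opprB.
    by rewrite mulrC ler_pdivrMr // mulrAC -mulrA.
  apply: lerXn2r; rewrite ?nnegrE ?expR_ge0 ?subr_ge0 //.
  have -> : 1 - k%:R^-1 = (1 + k.-1%:R^-1)^-1 :> R.
    by rewrite kk; field; rewrite !gt_eqF //; lra.
  by rewrite expRN lef_pV2 ?posrE ?expR_gt0 ?expR_ge1Dx // addr_gt0 ?invr_gt0.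
have q_le1 : q <= 1.
  by apply: exprn_ile1; rewrite ?subr_ge0 // gerBl invr_ge0.
have q_gt0 : 0 < q by apply: lt_le_trans q_ge; exact: expR_gt0.
have key : k%:R + m%:R * y ^+ 4 < q * r%:R.
  rewrite ltNge; apply/negP => qr_le.
  have : y ^+ 8 <= q * n%:R.
    rewrite nE mulrCA ler_peMr ?exprn_ge0 ?(ltW y_gt0) //.
    by rewrite expRN ler_pdivlMr ?expR_gt0 // mul1r.
  apply/negP; rewrite -ltNge.
  apply: (@le_lt_trans _ _ ((k%:R + m%:R * y ^+ 4) * m%:R ^+ 2)).
    apply: (@le_trans _ _ (q * (r%:R * m%:R ^+ 2))).
      by rewrite ler_pM2l // -natrX -natrM ler_nat.
    by rewrite mulrA ler_wpM2r // exprn_ge0.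
  apply: (@le_lt_trans _ _ ((k%:R + (K * y) * y ^+ 4) * (K * y) ^+ 2)).
    apply: ler_pM; rewrite ?exprn_ge0 ?addr_ge0 ?mulr_ge0 ?exprn_ge0 ?(ltW y_gt0) //.
    - by rewrite lerD2l ler_wpM2r // exprn_ge0 // ltW.
    - by rewrite lerXn2r ?nnegrE // (le_trans _ mKy).
  apply: (@le_lt_trans _ _ ((K ^+ 2 * k%:R + K ^+ 3) * y ^+ 7)).
    have y27 : y ^+ 2 <= y ^+ 7 by rewrite ler_eXn2l.
    have : K ^+ 2 * k%:R * y ^+ 2 <= K ^+ 2 * k%:R * y ^+ 7.
      by rewrite ler_wpM2l // mulr_ge0 // exprn_ge0 // (le_trans _ K_ge1).
    by lra.
  by rewrite [ltRHS]exprS ltr_pM2r // exprn_gt0.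
apply: (@le_lt_trans _ _ (expR k%:R * expR (y ^+ 4) ^+ m * expR (- q) ^+ r)).
  apply: ler_pM; rewrite ?mulr_ge0 ?exprn_ge0 ?subr_ge0 //.
    apply: ler_pM; rewrite ?exprn_ge0 //.
      by apply: le_trans (expR_ge1Dx _); rewrite lerDr.
    rewrite lerXn2r ?nnegrE ?expR_ge0 // -[leLHS]lnK ?ler_expR //.
    by rewrite posrE ltr0n.
  by rewrite lerXn2r ?nnegrE ?expR_ge0 ?subr_ge0 ?expR_ge1Dx.
rewrite -(expRM_natr m) -(expRM_natr r) -!expRD expR_lt1; lra.
Qed.

(** Take for m the integer part of (1 - e)(k - 1) L in [covering_complexity_ge]. *)
Lemma covering_complexity_ln_ge (R : realType) (T : finType) (G : {group {perm T}})
    (e : R) (k : nat) :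
    0 < e < 1 -> (1 < k)%N -> (1 < #|T|)%N -> (k ^ 2 <= #|T|)%N ->
    let L := ln (#|T|%:R : R) in
    let K := 8 * k%:R / e in
    K ^+ 2 * k%:R + K ^+ 3 < expR (e / 8 * L) ->
    ln (#|G|%:R : R) <= expR (e / 8 * L) ^+ 4 ->
    1 <= (1 - e) * (k.-1%:R * L) ->
  (((1 - e) * (k.-1%:R / k.+1%:R) * L)%:E <=
     covering_complexity (@permmod_action R T) G (deleted_module R T))%E.
Proof.
move=> e01 k_gt1 T_gt1 kT L K y_big G_le z_ge1; set z := (1 - e) * _ in z_ge1.
pose m := Num.truncn z.
have z_ge0 : 0 <= z by lra.
have m_gt0 : (0 < m)%N by rewrite truncn_gt0.
apply: le_trans (covering_complexity_ge T_gt1 k_gt1 m_gt0 kT _); last first.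
  move=> r; apply: (union_bound_lt1 e01 k_gt1 _ (cardG_gt0 G) y_big G_le).
    exact: ltnW.
  by rewrite truncn_le.
have -> : (1 - e) * (k.-1%:R / k.+1%:R) * L = z / k.+1%:R by rewrite /z; ring.
by rewrite lee_fin ler_pM2r ?invr_gt0 ?ltr0n // ltW // truncnS_gt.
Qed.

Local Open Scope classical_set_scope.

Theorem theorem6p3 (R : realType) (Omega : nat -> finType)
    (G : forall i : nat, {group {perm Omega i}})
    (G_2transitive : forall i : nat,
       [transitive^2 G i, on [set: Omega i]%SET | 'P])
    (degree_to_infty : #|Omega i| @[i --> \oo] --> \oo)
    (ln_order : exists delta : nat -> R,
       delta i @[i --> \oo] --> (0 : R) /\
       \forall i \near \oo,
         ln (#|G i|%:R : R) = (#|Omega i|%:R : R) `^ delta i) :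
  exists eps : nat -> R,
    eps i @[i --> \oo] --> (0 : R) /\
    \forall i \near \oo,
      covering_complexity (@permmod_action R (Omega i)) (G i)
          (deleted_module R (Omega i))
        = ((1 + eps i) * ln ((\dim (deleted_module R (Omega i)))%:R : R))%:E.
Proof.
pose CC i := covering_complexity (@permmod_action R (Omega i)) (G i) (deleted_module R (Omega i)).
pose L i := ln ((\dim (deleted_module R (Omega i)))%:R : R).
have card_large := (cvgnyPge _).1 degree_to_infty.
have L_large (x : R) : \forall i \near \oo, x <= L i.
  near=> i; have : ((Num.truncn (expR x)).+2 <= #|Omega i|)%N by near: i; exact: card_large.
  rewrite /L dim_deleted_module => n_large.
  have n_ge : expR x <= #|Omega i|.-1%:R.
    apply: le_trans (ltW (truncnS_gt _)) _.
    by rewrite ler_nat -ltnS prednK // (leq_trans _ n_large).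
  by rewrite -[leLHS]expRK ler_ln ?posrE ?expR_gt0 // (lt_le_trans (expR_gt0 x)).
have CC_le : \forall i \near \oo, (CC i <= (1 + L i)%:E)%E.
  near=> i; rewrite /L dim_deleted_module; apply: covering_complexity_le => //.
  by near: i; exact: card_large.
have CC_ge (e : R) : 0 < e < 1 -> \forall i \near \oo, (((1 - 2 * e) * L i)%:E <= CC i)%E.
  move=> e01; have /andP[e_gt0 e_lt1] := e01.
  (* This k makes (k - 1) / (k + 1) = 1 - 2 / (k + 1) at least 1 - e, so that the
     factor (1 - e) (k - 1) / (k + 1) is at least (1 - e) ^+ 2 >= 1 - 2 e. *)
  pose k := (Num.truncn (2 / e)).+2.
  have k_ge : 1 - e <= k.-1%:R / k.+1%:R.
    have kE : 2 / e < k.-1%:R := truncnS_gt _.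
    rewrite ltr_pdivrMr // in kE; rewrite ler_pdivlMr ?ltr0n //.
    have -> : k.+1%:R = k.-1%:R + 2 :> R by rewrite -natrD addn2.
    by lra.
  have [delta [delta0 deltaE]] := ln_order.
  pose K := 8 * k%:R / e.
  pose B := K ^+ 2 * k%:R + K ^+ 3.
  near=> i.
  have n_gt1 : (1 < #|Omega i|)%N by near: i; exact: card_large.
  have n1 : 1 <= #|Omega i|%:R :> R by rewrite ler1n ltnW.
  set Ln := ln (#|Omega i|%:R : R).
  have LLn : L i <= Ln.
    have N_gt0 : (0 < #|Omega i|.-1)%N by rewrite -ltnS prednK // ltnW.
    by rewrite /L dim_deleted_module ler_ln ?posrE ?ltr0n ?ler_nat ?leq_pred // ltnW.
  have L_ge0 : 0 <= L i by near: i; exact: L_large.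
  apply: le_trans (@covering_complexity_ln_ge R (Omega i) (G i) e k e01 _ n_gt1 _ _ _ _) => //.
  - rewrite lee_fin -/Ln; apply: (@le_trans _ _ ((1 - e) * (k.-1%:R / k.+1%:R) * L i)).
      rewrite ler_wpM2r //; apply: (@le_trans _ _ ((1 - e) * (1 - e))); first by nra.
      by rewrite ler_wpM2l //; lra.
    by rewrite ler_wpM2l // mulr_ge0 ?divr_ge0 //; lra.
  - by near: i; exact: card_large.
  - rewrite -/Ln -/K -/B; apply: lt_le_trans (expR_ge1Dx _).
    have B_le : B * (8 / e) <= L i by near: i; exact: L_large.
    have : e / 8 * (B * (8 / e)) <= e / 8 * Ln.
      by rewrite ler_wpM2l ?(le_trans B_le) // divr_ge0 // ltW.
    have -> : e / 8 * (B * (8 / e)) = B by field; rewrite gt_eqF.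
    by lra.
  - have -> : ln (#|G i|%:R : R) = (#|Omega i|%:R : R) `^ delta i by near: i.
    apply: le_trans (ler_powR n1 (_ : _ <= e / 2)) _.
      apply: le_trans (ler_norm _) _; near: i; apply: cvgr0_norm_le => //.
      by rewrite divr_gt0.
    rewrite -[in leLHS](@lnK _ #|Omega i|%:R) ?posrE ?ltr0n ?(ltnW n_gt1) //.
    by rewrite -expRM -expRM_natr ler_expR -/Ln; lra.
  - rewrite -/Ln; have L_ge : (1 - e)^-1 <= L i by near: i; exact: L_large.
    have e'_gt0 : 0 < 1 - e by lra.
    rewrite -ler_pdivrMl // mulr1 (le_trans L_ge) // (le_trans LLn) //.
    by rewrite ler_peMl ?ler1n // (le_trans L_ge0).
have CC_fin : \forall i \near \oo, CC i = (fine (CC i))%:E.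
  near=> i; rewrite fineK // fin_numElt.
  have lo : (((1 - 2 * 4^-1) * L i)%:E <= CC i)%E.
    by near: i; apply: CC_ge; rewrite invr_gt0 invf_lt1 ?ltr1n ?ltr0n.
  have hi : (CC i <= (1 + L i)%:E)%E by near: i.
  by rewrite (lt_le_trans _ lo) ?ltNyr // (le_lt_trans hi) ?ltry.
exists (fun i => fine (CC i) / L i - 1); split; last first.
  near=> i; rewrite -/(CC i) -/(L i).
  have L_ge1 : 1 <= L i by near: i; exact: L_large.
  have -> : CC i = (fine (CC i))%:E by near: i.
  by congr (_%:E); rewrite /=; field; lra.
apply/cvgr0Pnorm_le => /= e e_gt0.
pose e' := Num.min (e / 2) 2^-1.
have e'_gt0 : 0 < e' by rewrite lt_min; apply/andP; split; lra.
have e'_lt1 : e' < 1 by rewrite gt_min; apply/orP; right; lra.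
have e'_le : e' <= e / 2 by rewrite ge_min lexx.
near=> i.
have L_ge1 : 1 <= L i by near: i; exact: L_large.
have L_ge : e^-1 <= L i by near: i; exact: L_large.
have CCE : CC i = (fine (CC i))%:E by near: i.
have hi : (CC i <= (1 + L i)%:E)%E by near: i.
have lo : (((1 - 2 * e') * L i)%:E <= CC i)%E by near: i; apply: CC_ge; rewrite e'_gt0.
rewrite CCE !lee_fin in hi lo; set c := fine _ in hi lo *.
have Lp : 0 < L i by lra.
rewrite ler_norml lerBrDr lerBlDr ler_pdivlMr // ler_pdivrMr //.
have : 1 <= e * L i by rewrite -ler_pdivrMl // mulr1.
have : e' * L i <= e / 2 * L i by rewrite ler_wpM2r // ltW.
by move=> h1 h2; apply/andP; split; lra.
Unshelve. all: end_near.
Qed.
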